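(* Let $K$ be a field, let $\mathcal{A}$ be a finitely generated unital $K$-algebra, and let $\mathcal{A}=V\oplus W$ be a decomposition of $\mathcal{A}$ into the direct sum of two infinite dimensional almost invariant subspaces. Let $F\in\mathrm{End}_K(\mathcal{A})$ be defined by $F(v)=v$ for $v\in V$ and $F(w)=-w$ for $w\in W$. Then $p(a,b)=\mathrm{Tr}(r_a[F,r_b])$, for $a,b\in\mathcal{A}$, is a cyclic cocycle (a cyclic $1$-cocycle on $\mathcal{A}$). Moreover, the cyclic cohomology class in $HC^1(\mathcal{A})$ represented by $p$ depends only on the endclass associated to the decomposition $\mathcal{A}=V\oplus W$.
   Context: A $K$-linear subspace $V\subset\mathcal{A}$ is almost invariant if for every $x\in\mathcal{A}$ the quotient $(Vx+V)/V$ is finite dimensional over $K$. For $x\in\mathcal{A}$, $r_x\in\mathrm{End}_K(\mathcal{A})$ denotes right multiplication, $r_x(a)=ax$, and $[F,r_x]=Fr_x-r_xF$. Let $I\subset\mathrm{End}_K(\mathcal{A})$ be the ideal of endomorphisms of finite rank; for $T\in I$, $\mathrm{Tr}(T)$ is the trace of the restriction of $T$ to its (finite dimensional) range. In the setting of the claim, $[F,r_x]\in I$ for all $x\in\mathcal{A}$. Two decompositions $\mathcal{A}=V\oplus W$ and $\mathcal{A}=V'\oplus W'$ into almost invariant subspaces (with $V,V'$ infinite dimensional) determine the same endclass if $(V+V')/V$, $(V+V')/V'$, $(W+W')/W$ and $(W+W')/W'$ are all finite dimensional. A cyclic $1$-cocycle on $\mathcal{A}$ is a $K$-bilinear map $\tau:\mathcal{A}\times\mathcal{A}\to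 K$ with $\tau(a,b)=-\tau(b,a)$ and $\tau(ab,c)-\tau(a,bc)+\tau(ca,b)=0$ for all $a,b,c\in\mathcal{A}$. It is a cyclic coboundary if there is a $K$-linear functional $\varphi:\mathcal{A}\to K$ with $\tau(a,b)=\varphi(ab-ba)$ for all $a,b$. $HC^1(\mathcal{A})$ is the space of cyclic $1$-cocycles modulo cyclic coboundaries. *)

(* Defs.v *)
From HB Require Import structures.
From mathcomp Require Import all_boot all_order all_algebra.
From mathcomp Require Import boolp classical_sets.

Set Implicit Arguments.
Unset Strict Implicit.
Unset Printing Implicit Defensive.

Import GRing.Theory.

Local Open Scope classical_set_scope.
Local Open Scope ring_scope.

Section LinearAlgebra.
Variables (K : fieldType) (M : lmodType K).
Implicit Types (U V W : set M).

Definition is_subspace V : Prop := submod_closed [in V].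

Definition lspan n (e : 'I_n -> M) : set M :=
  [set x | exists c : 'I_n -> K, x = \sum_(i < n) c i *: e i].

Definition lin_indep n (e : 'I_n -> M) : Prop :=
  forall c : 'I_n -> K, \sum_(i < n) c i *: e i = 0 -> forall i, c i = 0.

Definition sum_set U V : set M := [set u + v | u in U & v in V].

Definition finite_dim U : Prop := exists n (e : 'I_n -> M), U = lspan e.

(* For subspaces V `<=` U: the quotient U / V is spanned by the classes of
   finitely many vectors. *)
Definition finite_dim_quot U V : Prop :=
  exists n (e : 'I_n -> M), U = sum_set V (lspan e).

Definition direct_sum V W : Prop :=
  sum_set V W = setT /\ V `&` W = [set 0].

Definition finite_rank (T : {linear M -> M}) : Prop := finite_dim (range T).

(* B is the matrix, in the basis e of the range of T, of the restriction of T
   to its range.  The value is 0 when T does not have finite rank. *)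
Definition Tr (T : {linear M -> M}) : K :=
  xget 0 [set t | exists n (e : 'I_n -> M) (B : 'M[K]_n),
    [/\ lin_indep e,
        range T = lspan e,
        forall j, T (e j) = \sum_(i < n) B i j *: e i
      & t = \tr B]].

Definition commutator (S T : {linear M -> M}) : {linear M -> M} :=
  (S \o T) \- (T \o S).

End LinearAlgebra.

Section Algebra.
Variables (K : fieldType) (A : algType K).
Implicit Types (V W : set A).

Definition finitely_generated : Prop :=
  exists s : seq A,
    smallest (fun B : set A => subalg_closed [in B]) [set` s] = setT.

(* a |-> a * x *)
Definition rmul (x : A) : {linear A -> A} := x \o* idfun.

Definition almost_invariant V : Prop :=
  is_subspace V /\
  forall x : A, finite_dim_quot (sum_set (rmul x @` V) V) V.

Definition ai_decomposition V W : Prop :=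
  [/\ almost_invariant V, almost_invariant W & direct_sum V W].

Definition same_endclass V W V' W' : Prop :=
  [/\ ai_decomposition V W /\ ~ finite_dim V,
      ai_decomposition V' W' /\ ~ finite_dim V',
      finite_dim_quot (sum_set V V') V /\ finite_dim_quot (sum_set V V') V'
    & finite_dim_quot (sum_set W W') W /\ finite_dim_quot (sum_set W W') W'].

Definition is_sign_of V W (F : {linear A -> A}) : Prop :=
  (forall v, V v -> F v = v) /\ (forall w, W w -> F w = - w).

Definition trace_pairing (F : {linear A -> A}) (a b : A) : K :=
  Tr (rmul a \o commutator F (rmul b)).

Definition cyclic_1cocycle (tau : A -> A -> K) : Prop :=
  [/\ (forall a, scalar (tau a)) /\ (forall b, scalar (tau^~ b)),
      forall a b, tau a b = - tau b a
    & forall a b c, tau (a * b) c - tau a (b * c) + tau (c * a) b = 0].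

Definition cyclic_1coboundary (tau : A -> A -> K) : Prop :=
  exists phi : {scalar A}, forall a b, tau a b = phi (a * b - b * a).

(* The elements of HC^1(A) are the cosets of the cyclic coboundaries in the
   space of cyclic 1-cocycles; this is the coset of tau. *)
Definition HC1_class (tau : A -> A -> K) : set (A -> A -> K) :=
  [set sigma | cyclic_1cocycle sigma /\
               cyclic_1coboundary (fun a b => sigma a b - tau a b)].

End Algebra.

Arguments finitely_generated {K} A.

(* Main.v *)
(* A finite-rank operator factors as T x = sum_i f_i(x) e_i through K^n, and its
   trace is sum_i f_i(e_i) for every such factorization; linearity of the trace
   and Tr (S T) = Tr (T S) are then immediate.  Modulo V, the operator F - 1
   sees only finitely many dimensions of V x, and F + 1 only finitely many of
   W x modulo W, so [F, r_x] has finite rank.  As x |-> r_x reverses products,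
   [F, r_(bc)] = [F, r_c] r_b + r_c [F, r_b], which gives the cocycle identity;
   F^2 = 1 makes [F, r_x] anticommute with F, so that 2 Tr [F, r_x] = 0; since
   F = 1 in characteristic 2, Tr [F, r_x] = 0 always, which gives antisymmetry.
   If (V', W') lies in the same endclass then F - F' has finite rank, and the
   difference of the cocycles is the coboundary of
   x |-> Tr ((F - F') r_x). *)

Require Import Defs.
From HB Require Import structures.
From mathcomp Require Import all_boot all_order all_algebra.
From mathcomp Require Import boolp classical_sets.

Set Implicit Arguments.
Unset Strict Implicit.
Unset Printing Implicit Defensive.

Import GRing.Theory.

Local Open Scope classical_set_scope.
Local Open Scope ring_scope.


(** Rank factorization [N = C B] has a left inverse [L] of [C] and a right inverse [R] of [B], so
    [L N N R = B C]. Hence [N N = 0] gives [B C = 0], whose trace is that of [N]. *)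
Lemma mxtrace_sqr0 (K : fieldType) n (N : 'M[K]_n) : N *m N = 0 -> \tr N = 0.
Proof.
move=> NN0; have [L LC] := row_fullP (col_base_full N).
have [R BR] := row_freeP (row_base_free N).
move: (mulmx_base N) L LC R BR NN0.
move: (\rank N) (col_base N) (row_base N) => r C B <- L LC R BR CBCB0.
rewrite mxtrace_mulC; have : L *m (C *m B *m (C *m B)) *m R = 0.
  by rewrite CBCB0 mulmx0 mul0mx.
by rewrite !mulmxA LC mul1mx -mulmxA BR mulmx1 => ->; rewrite mxtrace0.
Qed.

(** * Finite spans and free families *)

Section FiniteRank.
Variables (K : fieldType) (M : lmodType K).
Implicit Types (S T R : {linear M -> M}) (U V W : set M).

Lemma lspan_lin n (e : 'I_n -> M) k x y :
  lspan e x -> lspan e y -> lspan e (k *: x + y).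
Proof.
move=> [c ->] [d ->]; exists (fun i => k * c i + d i).
rewrite scaler_sumr -big_split /=; apply: eq_bigr => i _.
by rewrite scalerDl scalerA.
Qed.

Lemma lspan0 n (e : 'I_n -> M) : lspan e 0.
Proof. by exists (fun=> 0); rewrite big1 // => i _; rewrite scale0r. Qed.

Lemma lspan_mem n (e : 'I_n -> M) i : lspan e (e i).
Proof.
exists (fun j => (j == i)%:R); rewrite (bigD1 i) //= eqxx scale1r.
by rewrite big1 ?addr0 // => j /negbTE ->; rewrite scale0r.
Qed.

Lemma lspan_min n (e : 'I_n -> M) U :
    U 0 -> (forall k x y, U x -> U y -> U (k *: x + y)) ->
  (forall i, U (e i)) -> lspan e `<=` U.
Proof.
move=> U0 Ulin Ue _ [c ->]; elim/big_rec: _ => // i x _ Ux.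
exact: Ulin.
Qed.

Definition ord_cat X n m (e : 'I_n -> X) (e' : 'I_m -> X)
    (i : 'I_(n + m)) : X :=
  match split i with inl j => e j | inr j => e' j end.

Lemma ord_catl X n m (e : 'I_n -> X) (e' : 'I_m -> X) i :
  ord_cat e e' (lshift m i) = e i.
Proof. by rewrite /ord_cat (unsplitK (inl _)). Qed.

Lemma ord_catr X n m (e : 'I_n -> X) (e' : 'I_m -> X) i :
  ord_cat e e' (rshift n i) = e' i.
Proof. by rewrite /ord_cat (unsplitK (inr _)). Qed.

Lemma lspan_catl n m (e : 'I_n -> M) (e' : 'I_m -> M) :
  lspan e `<=` lspan (ord_cat e e').
Proof.
apply: lspan_min => [|k x y|i]; [exact: lspan0|exact: lspan_lin|].
by rewrite -(ord_catl e e'); apply: lspan_mem.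
Qed.

Lemma lspan_catr n m (e : 'I_n -> M) (e' : 'I_m -> M) :
  lspan e' `<=` lspan (ord_cat e e').
Proof.
apply: lspan_min => [|k x y|i]; [exact: lspan0|exact: lspan_lin|].
by rewrite -(ord_catr e e'); apply: lspan_mem.
Qed.

(** A row vector killing the matrix of coefficients of [e'] in [e] is a linear relation among the
    [e']. That matrix is therefore row free, which bounds [m] by its number of columns. *)
Lemma lin_indep_leq n m (e : 'I_n -> M) (e' : 'I_m -> M) :
  lin_indep e' -> (forall j, lspan e (e' j)) -> (m <= n)%N.
Proof.
move=> e'free /choice[C e'E].
pose B : 'M[K]_(m, n) := \matrix_(j, i) C j i.
suff /eqP <- : row_free B by exact: rank_leq_col.
apply: inj_row_free => u uB0; apply/rowP => j; rewrite mxE.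
apply: (e'free (fun j => u 0 j)) j.
under eq_bigr => j _ do rewrite e'E scaler_sumr.
rewrite exchange_big big1 //= => i _.
have /rowP/(_ i) := uB0; rewrite !mxE => uBi.
under eq_bigr => j _ do rewrite scalerA.
rewrite -scaler_suml (_ : \sum_j _ = 0) ?scale0r //.
by rewrite -[RHS]uBi; apply: eq_bigr => j _; rewrite mxE.
Qed.

Lemma lin_indep_extend n (e : 'I_n -> M) x : lin_indep e -> ~ lspan e x ->
  lin_indep (fun i => if unlift ord0 i is Some j then e j else x).
Proof.
move=> efree xNe c; rewrite big_ord_recl unlift_none.
under eq_bigr => j _ do rewrite liftK.
move=> c0; have c00 : c ord0 = 0.
  apply/eqP/negPn/negP => cN0; apply: xNe.
  exists (fun j => - ((c ord0)^-1 * c (lift ord0 j))).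
  under eq_bigr => j _ do rewrite scaleNr -scalerA.
  rewrite sumrN -scaler_sumr -(addr0_eq c0) scalerN opprK scalerA.
  by rewrite mulVf ?scale1r.
move: c0; rewrite c00 scale0r add0r => c0 i.
case: (unliftP ord0 i) => [j|] -> //.
exact: (efree (fun j => c (lift ord0 j))).
Qed.

(** Take a free family in [U] of maximal length, which exists because [n] bounds all lengths; a
    vector of [U] outside its span would extend it. *)
Lemma exists_lin_indep n (e : 'I_n -> M) U : U `<=` lspan e ->
  exists m (e' : 'I_m -> M),
    [/\ lin_indep e', forall j, U (e' j) & U `<=` lspan e'].
Proof.
move=> Ue; pose P m := `[< exists e' : 'I_m -> M,
  lin_indep e' /\ forall j, U (e' j) >].
have P0 : exists m, P m.
  by exists 0%N; apply/asboolP; exists (fun=> 0); split=> [c _|] [].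
have Pn m : P m -> (m <= n)%N.
  move=> /asboolP[e' [e'free Ue']].
  by apply: lin_indep_leq e'free _ => j; apply/Ue/Ue'.
have [m /asboolP[e' [e'free Ue']] mmax] := ex_maxnP P0 Pn.
exists m, e'; split=> // x Ux; apply: contrapT => xNe'.
suff /mmax : P m.+1 by rewrite ltnn.
apply/asboolP; eexists; split; first exact: lin_indep_extend e'free xNe'.
by move=> j /=; case: unliftP.
Qed.

(** * Factorizations through K^n and the trace *)

Lemma scalar_of_fun (g : M -> K) : scalar g -> exists f : {scalar M}, f =1 g.
Proof.
move=> glin; pose gL := GRing.isLinear.Build K M K *%R g glin.
by exists (HB.pack g gL : {scalar M}).
Qed.

Lemma lin_indep_inj n (e : 'I_n -> M) (c d : 'I_n -> K) : lin_indep e ->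
  \sum_(i < n) c i *: e i = \sum_(i < n) d i *: e i -> c =1 d.
Proof.
move=> efree cd i; apply/eqP; rewrite -subr_eq0; apply/eqP.
apply: (efree (fun i => c i - d i)) i.
under eq_bigr => i _ do rewrite scalerBl.
by rewrite sumrB cd subrr.
Qed.

(** Coordinates chosen pointwise are automatically linear, because coordinates in a free family are
    unique. *)
Lemma lin_indep_coord n (e : 'I_n -> M) T : lin_indep e ->
    range T `<=` lspan e ->
  exists f : 'I_n -> {scalar M}, forall x, T x = \sum_(i < n) f i x *: e i.
Proof.
move=> efree Te.
have /choice[c Tc] : forall x, lspan e (T x) by move=> x; apply: Te; exists x.
have clin i : exists f : {scalar M}, f =1 c^~ i.
  apply: scalar_of_fun => k x y.
  apply: (lin_indep_inj (d := fun i => k * c x i + c y i) efree) i.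
  rewrite -Tc linearP !Tc scaler_sumr -big_split /=.
  by apply: eq_bigr => i _; rewrite scalerDl scalerA.
have [f fE] := choice clin.
by exists f => x; rewrite Tc; apply: eq_bigr => i _; rewrite fE.
Qed.

Lemma range_basis n (e : 'I_n -> M) T : range T `<=` lspan e ->
  exists m (e' : 'I_m -> M), lin_indep e' /\ range T = lspan e'.
Proof.
move=> /exists_lin_indep[m [e' [e'free Te' e'T]]]; exists m, e'; split=> //.
apply/seteqP; split=> //; apply: lspan_min => //.
  by exists 0; rewrite ?linear0.
by move=> k _ _ [x _ <-] [y _ <-]; exists (k *: x + y); rewrite ?linearP.
Qed.

Lemma finite_rank_sub n (e : 'I_n -> M) T :
  range T `<=` lspan e -> finite_rank T.
Proof. by move=> /range_basis[m [e' [_ Te']]]; exists m, e'. Qed.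

(** The vectors [e] may be dependent here, so factorizations can be concatenated or composed without
    choosing a new basis of the range. *)
Lemma finite_rankP T : finite_rank T <->
  exists n (e : 'I_n -> M) (f : 'I_n -> {scalar M}),
    forall x, T x = \sum_(i < n) f i x *: e i.
Proof.
split=> [[n [e Te]]|[n [e [f Tf]]]].
  have /range_basis[m [e' [e'free Te']]] : range T `<=` lspan e by rewrite Te.
  have [|f Tf] := @lin_indep_coord _ e' T e'free; first by rewrite Te'.
  by exists m, e', f.
apply: (@finite_rank_sub _ e) => _ [x _ <-].
by exists (f^~ x).
Qed.

(* The two traces differ by that of N = (f_i e_j) - C (g_k e_j), where
   e' = e C; since e N = 0, N kills its own columns. *)
Lemma factorization_trace n m (e : 'I_n -> M) (e' : 'I_m -> M)
    (f : 'I_n -> {scalar M}) (g : 'I_m -> {scalar M}) T :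
    (forall x, T x = \sum_(i < n) f i x *: e i) ->
    (forall x, T x = \sum_(j < m) g j x *: e' j) ->
    (forall j, lspan e (e' j)) ->
  \sum_(i < n) f i (e i) = \sum_(j < m) g j (e' j).
Proof.
move=> Tf Tg /choice[c e'E].
pose P : 'M[K]_n := \matrix_(i, j) f i (e j).
pose G : 'M[K]_(m, n) := \matrix_(k, j) g k (e j).
pose C : 'M[K]_(n, m) := \matrix_(i, k) c k i.
have eN j : \sum_i (P - C *m G) i j *: e i = 0.
  under eq_bigr => i _ do rewrite !mxE scalerBl.
  rewrite sumrB -Tf Tg; apply/eqP; rewrite subr_eq0; apply/eqP.
  under [RHS]eq_bigr => i _ do rewrite scaler_suml.
  rewrite exchange_big /=; apply: eq_bigr => k _.
  rewrite e'E scaler_sumr; apply: eq_bigr => i _.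
  by rewrite !mxE scalerA mulrC.
(* Stated for any family of forms, so that it applies to both [f] (the matrix [P]) and [g] (the
   matrix [G]). *)
have mulN p (h : 'I_p -> {scalar M}) :
    (\matrix_(i, j) h i (e j)) *m (P - C *m G) = 0.
  apply/matrixP => i j; rewrite !mxE -[RHS](linear0 (h i)) -(eN j) linear_sum.
  by apply: eq_bigr => k _; rewrite scalarZ mxE mulrC.
have: \tr (P - C *m G) = 0.
  by apply: mxtrace_sqr0; rewrite mulmxBl -mulmxA !mulN mulmx0 subr0.
rewrite linearB /= mxtrace_mulC => /subr0_eq PG.
transitivity (\tr P); first by apply: eq_bigr => i _; rewrite mxE.
rewrite PG; apply: eq_bigr => k _; rewrite mxE e'E linear_sum.
by apply: eq_bigr => i _; rewrite scalarZ !mxE mulrC.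
Qed.

(** A basis of the range yields a second factorization whose vectors lie in the span of [e], so
    [factorization_trace] compares the two. *)
Lemma TrE n (e : 'I_n -> M) (f : 'I_n -> {scalar M}) T :
    (forall x, T x = \sum_(i < n) f i x *: e i) ->
  Tr T = \sum_(i < n) f i (e i).
Proof.
move=> Tf; have Te : range T `<=` lspan e by move=> _ [x _ <-]; exists (f^~ x).
have uniq t m (e' : 'I_m -> M) (B : 'M[K]_m) :
    [/\ lin_indep e', range T = lspan e',
        forall j, T (e' j) = \sum_(i < m) B i j *: e' i & t = \tr B] ->
    t = \sum_(i < n) f i (e i).
  move=> [e'free Te' TB ->].
  have [|g Tg] := @lin_indep_coord _ e' T e'free; first by rewrite Te'.
  rewrite (factorization_trace Tf Tg) => [|j].
    apply: eq_bigr => j _.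
    (* Column [j] of [B] and the values [g i (e' j)] are both the coordinates of [T (e' j)]; only
       the diagonal entry is used. *)
    apply: (lin_indep_inj (c := B^~ j) (d := fun i => g i (e' j)) e'free).
    by rewrite -Tg TB.
  by apply: Te; rewrite Te'; apply: lspan_mem.
(* The default value of [xget] is ruled out by exhibiting a basis of the range; [uniq] settles every
   other candidate. *)
apply: xget_unique => [|t [m [e' [B]]]]; last exact: uniq.
have [m [e' [e'free Te']]] := range_basis Te.
have [|g Tg] := @lin_indep_coord _ e' T e'free; first by rewrite Te'.
pose B : 'M[K]_m := \matrix_(i, j) g i (e' j).
have BP : [/\ lin_indep e', range T = lspan e',
        forall j, T (e' j) = \sum_(i < m) B i j *: e' i & \tr B = \tr B].
  by split=> // j; rewrite Tg; apply: eq_bigr => i _; rewrite mxE.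
exists m, e', B; have [_ _ TB _] := BP; split=> //.
exact/esym/(uniq _ _ _ _ BP).
Qed.

(** * Linearity and cyclicity of the trace *)

(** Concatenated factorizations of [k S] and [T] factor [R]. Asking only for pointwise equality lets
    operator identities be checked on elements. *)
Lemma Tr_lin k S T R : finite_rank S -> finite_rank T ->
  (forall x, R x = k *: S x + T x) -> Tr R = k * Tr S + Tr T.
Proof.
move=> /finite_rankP[n [e [f Sf]]] /finite_rankP[m [e' [g Tg]]] RE.
rewrite (TrE Sf) (TrE Tg).
rewrite (@TrE _ (ord_cat (fun i => k *: e i) e') (ord_cat f g)) => [|x].
  rewrite big_split_ord mulr_sumr /=; congr (_ + _); apply: eq_bigr => i _.
    by rewrite !ord_catl scalarZ.
  by rewrite !ord_catr.
rewrite RE Sf Tg big_split_ord scaler_sumr /=; congr (_ + _).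
  by apply: eq_bigr => i _; rewrite !ord_catl !scalerA mulrC.
by apply: eq_bigr => i _; rewrite !ord_catr.
Qed.

Lemma finite_rank_lin k S T R : finite_rank S -> finite_rank T ->
  (forall x, R x = k *: S x + T x) -> finite_rank R.
Proof.
move=> [n [e Se]] [m [e' Te']] RE.
apply: (@finite_rank_sub _ (ord_cat e e')) => _ [x _ <-]; rewrite RE.
apply: lspan_lin; [apply: lspan_catl; rewrite -Se|apply: lspan_catr; rewrite -Te'];
  by exists x.
Qed.

Lemma Tr_ext S T : finite_rank S -> S =1 T -> Tr S = Tr T.
Proof.
move=> /finite_rankP[n [e [f Sf]]] ST.
by rewrite (TrE Sf) (@TrE _ e f) // => x; rewrite -ST.
Qed.

Lemma finite_rank_compr S T : finite_rank S -> finite_rank (S \o T).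
Proof.
move=> [n [e Se]]; apply: (@finite_rank_sub _ e) => _ [x _ <-].
by rewrite -Se; exists (T x).
Qed.

Lemma finite_rank_compl S T : finite_rank S -> finite_rank (T \o S).
Proof.
move=> /finite_rankP[n [e [f Sf]]].
apply/finite_rankP; exists n, (T \o e), f => x /=.
by rewrite Sf linear_sum; apply: eq_bigr => i _; rewrite linearZ.
Qed.

(** If [S] is given by vectors [e i] and forms [f i], then [T S] has vectors [T (e i)] and [S T] has
    forms [f i \o T]; both traces are the sum of the [f i (T (e i))]. *)
Lemma TrC S T : finite_rank S -> Tr (S \o T) = Tr (T \o S).
Proof.
move=> /finite_rankP[n [e [f Sf]]].
rewrite (@TrE _ (T \o e) f (T \o S)) => [|x /=]; last first.
  by rewrite Sf linear_sum; apply: eq_bigr => i _; rewrite linearZ.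
by rewrite (@TrE _ e (fun i => f i \o T) (S \o T)) // => x /=; rewrite Sf.
Qed.

(** * Finite rank from finite-dimensional quotients *)

Lemma finite_dim_quot_image T V U : (forall v, V v -> T v = 0) ->
    finite_dim_quot U V ->
  exists n (e : 'I_n -> M), forall u, U u -> lspan e (T u).
Proof.
move=> TV [n [e UE]]; exists n, (T \o e) => u; rewrite UE.
move=> [v Vv [_ [c ->] <-]]; exists c.
rewrite linearD TV // add0r linear_sum.
by apply: eq_bigr => i _; rewrite linearZ.
Qed.

Lemma finite_rank_direct_sum T V W n m (e : 'I_n -> M) (e' : 'I_m -> M) :
    direct_sum V W -> (forall v, V v -> lspan e (T v)) ->
    (forall w, W w -> lspan e' (T w)) ->
  finite_rank T.
Proof.
move=> [VW _] TV TW; apply: (@finite_rank_sub _ (ord_cat e e')) => _ [x _ <-].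
have [v Vv [w Ww <-]] : sum_set V W x by rewrite VW.
rewrite linearD -[T v]scale1r; apply: lspan_lin.
  exact/lspan_catl/TV.
exact/lspan_catr/TW.
Qed.
End FiniteRank.

(** * The cocycle of a decomposition *)

Section SignCocycle.
Variables (K : fieldType) (A : algType K).
Implicit Types (V W : set A) (F D : {linear A -> A}).

Lemma rmulE (x y : A) : rmul x y = y * x. Proof. by []. Qed.

Lemma commutatorE F D x : commutator F D x = F (D x) - D (F x).
Proof. by []. Qed.

Lemma pairing_opE F a b x :
  (rmul a \o commutator F (rmul b) : {linear A -> A}) x =
    (F (x * b) - F x * b) * a.
Proof. by []. Qed.

Lemma subspace0 V : is_subspace V -> V 0.
Proof. by case=> + _; rewrite in_setE. Qed.

Lemma almost_invariant0 V : almost_invariant V -> V 0.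
Proof. by case=> /subspace0. Qed.

(** On [V] the commutator is [v |-> (F - 1)(v x)], on [W] it is [w |-> (F + 1)(w x)]; [F - 1] kills
    [V] and [F + 1] kills [W]. *)
Lemma finite_rank_commutator V W F : ai_decomposition V W -> is_sign_of V W F ->
  forall x, finite_rank (commutator F (rmul x)).
Proof.
move=> [aiV aiW VW] [FV FW] x.
have [|n [e He]] := @finite_dim_quot_image _ _ (F \- idfun) _ _ _ (aiV.2 x).
  by move=> v Vv; rewrite /= FV // subrr.
have [|m [e' He']] := @finite_dim_quot_image _ _ (F \+ idfun) _ _ _ (aiW.2 x).
  by move=> w Ww; rewrite /= FW // addNr.
have sub U (y : A) : almost_invariant U -> U y ->
    sum_set (rmul x @` U) U (rmul x y).
  move=> aiU Uy; exists (rmul x y); first by exists y.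
  by exists 0; rewrite ?addr0 //; apply: almost_invariant0.
apply: (@finite_rank_direct_sum _ _ _ V W _ _ e e') => // [v Vv|w Ww].
  have -> : commutator F (rmul x) v = (F \- idfun) (rmul x v).
    by rewrite commutatorE (FV v).
  exact/He/sub.
have -> : commutator F (rmul x) w = (F \+ idfun) (rmul x w).
  by rewrite commutatorE (FW w) // linearN opprK.
exact/He'/sub.
Qed.

Lemma sign_involutive V W F : direct_sum V W -> is_sign_of V W F ->
  involutive F.
Proof.
move=> [VW _] [FV FW] x; have [v Vv [w Ww <-]] : sum_set V W x by rewrite VW.
by rewrite linearD (FV v) // (FW w) // linearB (FV v) // (FW w) // opprK.
Qed.

Lemma Tr_commutator V W F x : ai_decomposition V W -> is_sign_of V W F ->
  Tr (commutator F (rmul x)) = 0.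
Proof.
move=> dVW sF; have fin := finite_rank_commutator dVW sF x.
have [_ _ VW] := dVW; have FF := sign_involutive VW sF.
set C := commutator _ _ in fin *.
have CE y : C y = F (y * x) - F y * x by [].
clearbody C.
have FCF y : (F \o C \o F) y = - C y.
  by rewrite -[LHS]/(F (C (F y))) !CE linearB !FF opprB.
have TrFCF : Tr (F \o C \o F) = Tr C.
  rewrite TrC; last exact: finite_rank_compl.
  by apply/esym/Tr_ext => // y /=; rewrite FF.
have two_Tr : 2 * Tr C = 0.
  (* Writing [- C] as [-2 C + C] puts it in the shape of [Tr_lin]. *)
  have : Tr (F \o C \o F) = - 2 * Tr C + Tr C.
    apply: (Tr_lin fin fin) => y.
    by rewrite [LHS]FCF scaleNr scaler_nat mulr2n opprD addrNK.
  rewrite TrFCF -{1}[Tr C]add0r => /addIr/esym/eqP.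
  by rewrite mulNr oppr_eq0 => /eqP.
have [char2|/negbTE two_neq0] := eqVneq (2 : K) 0; last first.
  by apply/eqP; move/eqP: two_Tr; rewrite mulf_eq0 two_neq0.
have F1 y : F y = y.
  have [VW1 _] := VW; have [v Vv [w Ww <-]] : sum_set V W y by rewrite VW1.
  rewrite linearD (proj1 sF) // (proj2 sF) //; congr (v + _).
  by apply/esym/eqP; rewrite -addr_eq0 -mulr2n -scaler_nat char2 scale0r.
have C0 y : C y = 0 by rewrite CE !F1 subrr.
(* Since [C] vanishes, [C = 1 C + C], so its trace [t] satisfies [t = t + t]. *)
apply/eqP; rewrite -(inj_eq (addrI (Tr C))) addr0; apply/eqP.
rewrite -{1}[Tr C]mul1r; apply/esym/(Tr_lin fin fin) => y.
by rewrite C0 scaler0 addr0.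
Qed.

Lemma trace_pairing_cyclic V W F : ai_decomposition V W -> is_sign_of V W F ->
  cyclic_1cocycle (trace_pairing F).
Proof.
move=> dVW sF; have fin := finite_rank_commutator dVW sF.
have finl a b : finite_rank (rmul a \o commutator F (rmul b)).
  exact: finite_rank_compl.
split=> [|a b|a b c].
- split=> [a k b b'|b k a a']; apply: Tr_lin => // x.
    rewrite !pairing_opE !mulrDr -!scalerAr linearD linearZ opprD addrACA.
    by rewrite -scalerBr mulrDl scalerAl.
  by rewrite !pairing_opE mulrDr scalerAr.
(* Take traces in [[F, r_(ba)] = [F, r_a] r_b + r_a [F, r_b]]: the left side gives 0, and cyclicity
   turns the first term into the pairing of [b] and [a]. *)
- have : Tr (commutator F (rmul (b * a))) =
      1 * Tr (commutator F (rmul a) \o rmul b) + trace_pairing F a b.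
    apply: Tr_lin => // [|x]; first exact: finite_rank_compr.
    rewrite pairing_opE commutatorE scale1r
      -[X in _ = X + _]/(F (x * b * a) - F (x * b) * a).
    by rewrite !rmulE mulrBl !mulrA addrA addrNK.
  rewrite (Tr_commutator _ dVW sF) mul1r (TrC _ (fin a)) addrC.
  by move/esym/eqP; rewrite addr_eq0 => /eqP.
(* With [S = r_a [F, r_c]], the first term is [Tr (r_b S) = Tr (S r_b)], and expanding [[F, r_(bc)]]
   makes the second [Tr (S r_b)] plus the third. *)
- pose S : {linear A -> A} := rmul a \o commutator F (rmul c).
  have -> : trace_pairing F (a * b) c = Tr (S \o rmul b).
    rewrite (TrC (rmul b) (finl a c)); apply: Tr_ext => // x.
    by rewrite pairing_opE -[RHS]/((F (x * c) - F x * c) * a * b) mulrA.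
  have -> : trace_pairing F a (b * c) =
      1 * Tr (S \o rmul b) + trace_pairing F (c * a) b.
    apply: Tr_lin => // [|x]; first exact: finite_rank_compr (finl a c).
    rewrite !pairing_opE scale1r
      -[X in _ = X + _]/((F (x * b * c) - F (x * b) * c) * a).
    by rewrite !mulrA -mulrDl; congr (_ * a); rewrite mulrBl addrA addrNK.
  by rewrite mul1r opprD addrA subrr add0r addNr.
Qed.

(** * Dependence on the endclass *)

(** As [D = F - F'] has finite rank, [r_a D r_b] and [r_a r_b D] have traces separately. By
    cyclicity these are [Tr (D r_(ab))] and [Tr (D r_(ba))], the values of [phi] at [a b] and
    [b a]. *)
Lemma trace_pairing_sub F F' : finite_rank (F \- F') ->
    (forall x, finite_rank (commutator F' (rmul x))) ->
  cyclic_1coboundary (fun a b => trace_pairing F a b - trace_pairing F' a b).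
Proof.
set D : {linear A -> A} := F \- F' => finD finF'.
have DE x : D x = F x - F' x by [].
clearbody D.
have [|phi phiE] := @scalar_of_fun K A (fun x => Tr (D \o rmul x)).
  move=> k x y; apply: Tr_lin; try exact: finite_rank_compr.
  by move=> z; rewrite /= mulrDr -scalerAr linearP.
exists phi => a b; rewrite linearB !phiE.
have finL : finite_rank ((rmul a \o rmul b) \o D) by exact: finite_rank_compl.
have finR : finite_rank (rmul a \o (D \o rmul b)).
  exact/finite_rank_compl/finite_rank_compr.
have EE x : (rmul a \o commutator D (rmul b)) x =
    -1 *: ((rmul a \o rmul b) \o D) x + (rmul a \o (D \o rmul b)) x.
  rewrite -[LHS]/((D (x * b) - D x * b) * a) 
    -[RHS]/(-1 *: (D x * b * a) + D (x * b) * a).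
  by rewrite scaleN1r mulrBl addrC.
have finE := finite_rank_lin finL finR EE.
have -> : trace_pairing F a b =
    1 * Tr (rmul a \o commutator D (rmul b)) + trace_pairing F' a b.
  apply: Tr_lin => // [|x]; first exact: finite_rank_compl.
  rewrite !pairing_opE scale1r -mulrDl; congr (_ * a).
  by rewrite !DE mulrBl opprD opprK addrACA addrNK addrK.
rewrite mul1r addrK (Tr_lin finL finR EE) mulN1r addrC; congr (_ - _).
  rewrite -TrC; last exact: finite_rank_compr.
  apply: Tr_ext => [|x]; first exact/finite_rank_compr/finite_rank_compr.
  by rewrite [RHS]/= mulrA.
rewrite -TrC //; apply: Tr_ext => [|x]; first exact: finite_rank_compr.
by rewrite [RHS]/= mulrA.
Qed.

(** On [V'] the difference is [F - 1], which kills [V] and so factors through the quotient of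
    [V + V'] by [V]; on [W'] it is [F + 1], which kills [W]. *)
Lemma finite_rank_sign_sub V W V' W' F F' : same_endclass V W V' W' ->
  is_sign_of V W F -> is_sign_of V' W' F' -> finite_rank (F \- F').
Proof.
move=> [[[aiV aiW _] _] [[_ _ VW'] _] [quotV _] [quotW _]] [FV FW] [FV' FW'].
have [|n [e He]] := @finite_dim_quot_image _ _ (F \- idfun) _ _ _ quotV.
  by move=> v Vv; rewrite /= FV // subrr.
have [|m [e' He']] := @finite_dim_quot_image _ _ (F \+ idfun) _ _ _ quotW.
  by move=> w Ww; rewrite /= FW // addNr.
have sub U U' (y : A) : almost_invariant U -> U' y -> sum_set U U' y.
  move=> aiU U'y; exists 0; first exact: almost_invariant0.
  by exists y; rewrite ?add0r.
apply: (@finite_rank_direct_sum _ _ _ V' W' _ _ e e') => // [v Vv|w Ww] /=.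
  by rewrite FV' //; apply/He/sub.
by rewrite FW' // opprK; apply/He'/sub.
Qed.

Lemma HC1_class_eq (tau tau' : A -> A -> K) :
  cyclic_1coboundary (fun a b => tau a b - tau' a b) ->
  HC1_class tau = HC1_class tau'.
Proof.
move=> [phi phiE]; apply/seteqP; split=> s [cs [psi psiE]]; split=> //.
  by exists (psi \+ phi) => a b; rewrite /= -psiE -phiE addrA addrNK.
by exists (psi \- phi) => a b; rewrite /= -psiE -phiE opprB addrA addrNK.
Qed.
End SignCocycle.

Theorem theorem2 (K : fieldType) (A : algType K)
    (hA : finitely_generated A)
    (V W : set A)
    (hVW : ai_decomposition V W)
    (hV : ~ finite_dim V) (hW : ~ finite_dim W)
    (F : {linear A -> A}) (hF : is_sign_of V W F) :
  (forall x : A, finite_rank (commutator F (rmul x))) /\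
  cyclic_1cocycle (trace_pairing F) /\
  (forall (V' W' : set A) (F' : {linear A -> A}),
     same_endclass V W V' W' -> is_sign_of V' W' F' ->
     HC1_class (trace_pairing F) = HC1_class (trace_pairing F')).
Proof.
have fin := finite_rank_commutator hVW hF.
split=> //; split; first exact: trace_pairing_cyclic hVW hF.
move=> V' W' F' sameVW hF'; apply: HC1_class_eq.
apply: trace_pairing_sub; first exact: finite_rank_sign_sub sameVW hF hF'.
by have [_ [hVW' _] _ _] := sameVW; apply: finite_rank_commutator hVW' hF'.
Qed.
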